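(* Let $A$ and $D$ be dcpo's, let $0\in D$ be a distinguished element, and let $x,y\in A$ satisfy $x\sqsubset_A y$ (i.e. $x\sqsubseteq_A y$ and $x\neq y$). Let $\rho:A\times A\to D$ be a Scott continuous function and let $\mathcal T[\rho]$ be a $T_0$ topology on $A$ such that for all $a,b\in A$, $\rho(a,b)=\rho(b,a)=0$ implies that for every $U\in\mathcal T[\rho]$, $a\in U$ iff $b\in U$. Then the double equality $\rho(x,x)=\rho(y,y)=0$ does not hold.
   Context: A dcpo is a poset with least element in which every (nonempty) directed subset has a least upper bound. $A\times A$ carries the coordinatewise order. A function between dcpo's is Scott continuous if it is monotone and preserves least upper bounds of (nonempty) directed subsets. A topology is $T_0$ if distinct points do not belong to exactly the same open sets. *)

(* Defs.v *)
From HB Require Import structures.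
From mathcomp Require Import all_boot all_order.
From mathcomp Require Import boolp classical_sets topology.

Set Implicit Arguments.
Unset Strict Implicit.
Unset Printing Implicit Defensive.

Import Order.TTheory.

Local Open Scope classical_set_scope.
Local Open Scope order_scope.

(* Nonemptiness is part of the definition. *)
Definition directed d (T : porderType d) (S : set T) : Prop :=
  S !=set0 /\
  forall a b : T, S a -> S b -> exists c : T, [/\ S c, a <= c & b <= c].

HB.mixin Record BPOrder_isDcpo d T of Order.BPOrder d T := {
  directed_lub : forall S : set T, directed S -> exists m : T, isLub S m
}.

#[short(type="dcpoType")]
HB.structure Definition Dcpo d :=
  { T of Order.BPOrder d T & BPOrder_isDcpo d T }.

(* No compatibility between the order and the topology is required. *)
#[short(type="topologicalDcpoType")]
HB.structure Definition TopologicalDcpo d :=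
  { T of Dcpo d T & Topological T }.

Definition scott_continuous d d' (T : porderType d) (T' : porderType d')
    (f : T -> T') : Prop :=
  {homo f : a b / a <= b} /\
  forall (S : set T) (m : T), directed S -> isLub S m ->
    isLub (f @` S) (f m).

(* Main.v *)
(** Monotonicity squeezes rho (x, y) and rho (y, x) between rho (x, x) and
    rho (y, y). If both bounds were zero, x and y would be topologically
    indistinguishable, hence equal. *)
Require Import Defs.
From mathcomp Require Import all_boot all_order.
From mathcomp Require Import boolp classical_sets topology separation_axioms.

(** In the product order [(x, y)] and [(y, x)] both lie between [(x, x)] and [(y, y)]. If [rho] is
    [zero] at both ends, it is [zero] at these mixed pairs, so no open set separates [x] from [y],
    and T0 contradicts [x < y]. *)

Lemma kolmogorov_space_eq (T : topologicalType) (a b : T) :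
  kolmogorov_space T -> (forall U : set T, open U -> (U a <-> U b)) -> a = b.
Proof.
move=> T0 indist; apply/eqP/negPn/negP => /T0[V VP].
(* The separating [V] is only a neighbourhood; indistinguishability is applied to an open set inside
   it. *)
suff [Vab Vba] : (nbhs a V -> V b) /\ (nbhs b V -> V a).
  by case: VP => -[]; rewrite !inE; [move/Vab | move/Vba].
by split; rewrite nbhsE => -[U [oU Ux]]; apply; apply/(indist U oU).
Qed.

Theorem theorem10p1p1 (dA dD : Order.disp_t)
    (A : topologicalDcpoType dA) (D : dcpoType dD) (zero : D)
    (x y : A) (ltxy : (x < y)%O)
    (rho : (A *p A)%type -> D) (rho_cont : scott_continuous rho)
    (T0 : kolmogorov_space A)
    (rho_open : forall a b : A, rho (a, b) = zero -> rho (b, a) = zero ->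
       forall U : set A, open U -> (U a <-> U b)) :
  ~ (rho (x, x) = zero /\ rho (y, y) = zero).
Proof.
case=> rxx ryy; have [rho_mono _] := rho_cont.
have lexy : (x <= y)%O := Order.POrderTheory.ltW ltxy.
have squeeze (p : (A *p A)%type) :
    ((x, x) <= p :> (A *p A)%type)%O -> (p <= (y, y) :> (A *p A)%type)%O ->
    rho p = zero.
  (* [zero] need not be the bottom of [D], so antisymmetry takes one bound from each diagonal
     value. *)
  move=> /rho_mono lep /rho_mono gep; apply: Order.POrderTheory.le_anti.
  by rewrite -{1}ryy gep -rxx lep.
have eqxy : x = y.
  apply: kolmogorov_space_eq T0 _; apply: rho_open; apply: squeeze;
    by rewrite Order.ProdOrder.leEprod /= lexy Order.POrderTheory.lexx.
by rewrite eqxy Order.POrderTheory.ltxx in ltxy.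
Qed.
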